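(* Let $\Phi$ be an irreducible monic polynomial of degree $d$, $1\le d\le[K(\chi):K]/2$, and assume that $\nu$ is a pm valuation on $K(\chi)$. Then $\Phi$ is a w key polynomial for $\nu$ if, and only if, the valued $K$-module $(K_\Phi,\nu)$ is a valued field.
   Context: $K$ is a field, $\chi\notin K$ is algebraic or transcendental over $K$; $[K[\chi]:K]=[K(\chi):K]=\infty$ if $\chi$ is transcendental. When $\chi$ is algebraic, elements of $K[\chi]$ are written uniquely as polynomials in $\chi$ of degree $<[K[\chi]:K]$. $K_m[\chi]$ is the $K$-module of polynomials of degree at most $m$. A $K$-module valuation is a map $\nu$ to $\Gamma\cup\{\infty\}$, $\Gamma$ a linearly ordered abelian group, such that $\nu(y)=\infty\Leftrightarrow y=0$, $\nu(y_1+y_2)\ge\min(\nu(y_1),\nu(y_2))$ and $\nu(xy)=\nu(x)+\nu(y)$ for $x\in K$. It is a pm (partially multiplicative) valuation if $\nu(fg)=\nu(f)+\nu(g)$ for all $f,g\in K[\chi]$ with $\deg(f)+\deg(g)<[K[\chi]:K]$; if $\chi$ is transcendental one requires moreover that $\nu$ is a field valuation on $K(\chi)$. It is assumed that $\nu K$ has finite rank. For $\Phi$ monic of degree $d\geq 1$ and $f,g\in K_{d-1}[\chi]$, $q_\Phi(f,g)$ and $r_\Phi(f,g)$ are the quotient and remainder of the euclidean division of $fg$ by $\Phi$. $\Phi$ is a w key polynomial for $\nu$ if $\nu(fg)=\nu(r_\Phi(f,g))$ for all $f,g\in K_{d-1}[\chi]$ with $\deg(f)+\deg(g)<[K[\chi]:K]$.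 For $\Phi$ irreducible with $d\le[K(\chi):K]/2$, $K_\Phi$ is the field $(K_{d-1}[\chi],+,\ast)$ with $f\ast g:=r_\Phi(f,g)$ (isomorphic to $K[X]/(\Phi(X))$). $(K_\Phi,\nu)$ denotes this field equipped with the restriction of $\nu$ to $K_{d-1}[\chi]$; it is a valued field when this restriction is a field valuation for the multiplication $\ast$, i.e. $\nu(f\ast g)=\nu(f)+\nu(g)$ for all $f,g$. *)

(* Defs.v *)
From mathcomp Require Import all_boot all_order all_algebra all_field.
From mathcomp Require Import classical_sets cardinality.

Set Implicit Arguments.
Unset Strict Implicit.
Unset Printing Implicit Defensive.

Import Order.TTheory GRing.Theory Num.Theory.

Local Open Scope classical_set_scope.
Local Open Scope ring_scope.

(* MathComp's [porderZmodType] requires neither totality of the order nor its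
   compatibility with the addition. *)
Definition linearly_ordered_group (G : porderZmodType) : Prop :=
  total (<=%R : rel G) /\ (forall x y z : G, x <= y -> z + x <= z + y).

(* G with a greatest element [None], playing the role of infinity. *)
Definition withInfty (G : Type) : Type := option G.

Section WithInfty.
Context {G : porderZmodType}.

Definition add_infty (a b : withInfty G) : withInfty G :=
  match a, b with
  | Some x, Some y => Some (x + y)
  | _, _ => None
  end.

Definition le_infty (a b : withInfty G) : bool :=
  match a, b with
  | _, None => true
  | None, Some _ => false
  | Some x, Some y => x <= y
  end.

Definition min_infty (a b : withInfty G) : withInfty G :=
  if le_infty a b then a else b.

(* The rank of A is the number of its proper convex subgroups. *)
Definition convex_subgroup (A H : set G) : Prop :=
  [/\ H `<=` A,
      H 0,
      forall x y, H x -> H y -> H (x - y)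
    & forall x y, A x -> H y -> 0 <= x -> x <= y -> H x].

Definition finite_rank (A : set G) : Prop :=
  finite_set [set H : set G | convex_subgroup A H].

Definition field_valuation (F : fieldType) (nu : F -> withInfty G) : Prop :=
  [/\ forall y, nu y = None <-> y = 0,
      forall y z, le_infty (min_infty (nu y) (nu z)) (nu (y + z))
    & forall y z, nu (y * z) = add_infty (nu y) (nu z)].

End WithInfty.

Section SimpleExtension.
Variables (K L : fieldType) (iota : {rmorphism K -> L}) (chi : L).

Definition eval_at (p : {poly K}) : L := (map_poly iota p).[chi].

(* K[chi] *)
Definition adjoin_ring : set L := [set y | exists p, y = eval_at p].

(* K(chi) *)
Definition adjoin_field : set L :=
  [set y | exists p q, eval_at q != 0 /\ y = eval_at p / eval_at q].

(* m <= [V : K], for V a K-subspace of L of finite or infinite dimension. *)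
Definition dim_geq (V : set L) (m : nat) : Prop :=
  exists2 v : 'I_m -> L, (forall i, V (v i)) &
    forall c : 'I_m -> K, \sum_i iota (c i) * v i = 0 -> forall i, c i = 0.

(* deg f + deg g < [K[chi] : K], where the zero polynomial is given degree 0. *)
Definition deg_sum_lt (f g : {poly K}) : Prop :=
  dim_geq adjoin_ring ((size f).-1 + (size g).-1).+1.

Variables (G : porderZmodType) (nu : L -> withInfty G).

Definition module_valuation : Prop :=
  [/\ forall y, nu y = None <-> y = 0,
      forall y z, le_infty (min_infty (nu y) (nu z)) (nu (y + z))
    & forall (x : K) y, nu (iota x * y) = add_infty (nu (iota x)) (nu y)].

(* Meant for L = K(chi), which is K[chi] when chi is algebraic. *)
Definition pm_valuation : Prop :=
  [/\ module_valuation,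
      forall f g : {poly K}, deg_sum_lt f g ->
        nu (eval_at f * eval_at g) =
          add_infty (nu (eval_at f)) (nu (eval_at g))
    & ~ algebraicOver iota chi -> field_valuation nu].

(* nu K *)
Definition base_value_group : set G :=
  [set a | exists x : K, nu (iota x) = Some a].

Definition w_key_polynomial (Phi : {poly K}) : Prop :=
  forall f g : {poly K},
    (size f < size Phi)%N -> (size g < size Phi)%N -> deg_sum_lt f g ->
    nu (eval_at f * eval_at g) = nu (eval_at ((f * g) %% Phi)).

(* K_Phi is the MathComp field [{poly %/ Phi with hPhi}]: its elements are the
   polynomials of size at most d = deg Phi, and its product is the remainder
   modulo Phi of the product of polynomials. *)
Definition residue_valuation (Phi : {poly K})
    (hPhi : monic_irreducible_poly Phi) :
    {poly %/ Phi with hPhi} -> withInfty G :=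
  fun f => nu (eval_at (f : {poly %/ Phi})).

End SimpleExtension.

Arguments residue_valuation {K L} iota chi {G} nu {Phi} hPhi f.

(* Main.v *)
Require Import Defs.
From mathcomp Require Import all_boot all_order all_algebra all_field.
From mathcomp Require Import classical_sets cardinality.

Set Implicit Arguments.
Unset Strict Implicit.
Unset Printing Implicit Defensive.

Import Order.TTheory GRing.Theory Num.Theory.

Local Open Scope classical_set_scope.
Local Open Scope ring_scope.

(* Since 2d <= [K(chi) : K], evaluation at chi is injective on polynomials of
   degree < 2d. Hence the condition deg f + deg g < [K[chi] : K] holds for all
   f, g of degree < d, where nu (f g) = nu f + nu g, so that nu (f g) and
   nu (r_Phi (f, g)) agree exactly when nu is multiplicative on K_Phi. *)

Section Evaluation.
Variables (K L : fieldType) (iota : {rmorphism K -> L}) (chi : L).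
Local Notation ev := (eval_at iota chi).

Lemma eval_at0 : ev 0 = 0.
Proof. by rewrite /eval_at rmorph0 horner0. Qed.

Lemma eval_at1 : ev 1 = 1.
Proof. by rewrite /eval_at rmorph1 hornerC. Qed.

Lemma eval_atD p q : ev (p + q) = ev p + ev q.
Proof. by rewrite /eval_at rmorphD hornerD. Qed.

Lemma eval_atM p q : ev (p * q) = ev p * ev q.
Proof. by rewrite /eval_at rmorphM hornerM. Qed.

Lemma eval_at_wide n (p : {poly K}) : (size p <= n)%N ->
  ev p = \sum_(i < n) iota p`_i * chi ^+ i.
Proof.
move=> sp; rewrite /eval_at (@horner_coef_wide _ n) ?size_map_poly //.
by apply: eq_bigr => i _; rewrite coef_map.
Qed.

Lemma eval_at_modp p q : ev q = 0 -> ev (p %% q) = ev p.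
Proof.
by move=> q0; rewrite [in RHS](divp_eq p q) eval_atD eval_atM q0 mulr0 add0r.
Qed.

(* The part of [p] prime to [q] still vanishes at [chi], so that a Bezout
   relation inverts [q] at [chi]. *)
Lemma eval_at_inv p q : p != 0 -> ev p = 0 -> ev q != 0 ->
  exists v, (ev q)^-1 = ev v.
Proof.
move=> p0 evp0 evq0; have : ev (gdcop q p) = 0.
  apply/rootP; rewrite gdcop_map root_gdco ?map_poly_eq0 //.
  by apply/andP; split; [apply/rootP | apply/rootP/eqP].
have /Bezout_eq1_coprimepP[[u v] /= /(congr1 ev)] := coprimep_gdco q p0.
rewrite eval_atD !eval_atM eval_at1 => uv g0; exists v.
by apply: (mulIf evq0); rewrite mulVf // -uv g0 mulr0 add0r.
Qed.

(** Denominators are inverted by [eval_at_inv], and reduction modulo [p] does not change values at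
    [chi]. Hence the powers of [chi] below [(size p).-1] span K(chi). *)
Lemma adjoin_field_small (p : {poly K}) : p != 0 -> ev p = 0 ->
  forall y, adjoin_field iota chi y ->
  exists2 r : {poly K}, (size r < size p)%N & y = ev r.
Proof.
move=> p0 evp0 y [f [q [evq0 ->]]].
have [v ->] := eval_at_inv p0 evp0 evq0.
exists ((f * v) %% p); first by rewrite ltn_modp.
by rewrite eval_at_modp // eval_atM.
Qed.

(** A relation [ev p = 0] would place [n] free vectors in the span of fewer than [n] powers of
    [chi]. *)
Lemma dim_geq_eval_neq0 n (p : {poly K}) : dim_geq iota (adjoin_field iota chi) n ->
  p != 0 -> (size p <= n)%N -> ev p != 0.
Proof.
move=> [v vF vfree] p0 sp; apply/negP => /eqP evp0.
have small i := adjoin_field_small p0 evp0 (vF i).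
have [i|r rP] := @fin_all_exists _ (fun=> {poly K})
    (fun i r => (size r <= (size p).-1)%N /\ v i = ev r).
  have [r sr vE] := small i; exists r; split=> //.
  by rewrite -ltnS prednK // size_poly_gt0.
set m := (size p).-1 in rP *.
have lt_mn : (m < n)%N by rewrite prednK // size_poly_gt0.
(* Row [i] holds coordinates of [v i] on the powers of [chi]. With more rows than columns, [M] has a
   nonzero left kernel vector [c], which is a linear relation between the [v i]. *)
pose M := \matrix_(i < n, j < m) (r i)`_j.
have : kermx M != 0.
  rewrite kermx_eq0 /row_free neq_ltn.
  by rewrite (leq_ltn_trans (rank_leq_col M)).
case/rowV0Pn=> c /sub_kermxP cM /eqP; apply.
apply/rowP => i; rewrite mxE; apply: vfree i.
transitivity (\sum_(j < m) iota ((c *m M) 0 j) * chi ^+ j); last first.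
  by rewrite cM big1 // => j _; rewrite mxE rmorph0 mul0r.
under [RHS]eq_bigr do rewrite mxE rmorph_sum mulr_suml.
rewrite exchange_big /=; apply: eq_bigr => i _.
have [sr ->] := rP i; rewrite (eval_at_wide sr) mulr_sumr.
by apply: eq_bigr => j _; rewrite mxE rmorphM mulrA.
Qed.

(** The free family is that of the first [n] powers of [chi]: a linear relation between them is a
    polynomial of size at most [n] vanishing at [chi]. *)
Lemma dim_geq_adjoin_ring n :
  (forall p : {poly K}, p != 0 -> (size p <= n)%N -> ev p != 0) ->
  dim_geq iota (adjoin_ring iota chi) n.
Proof.
move=> ev_neq0; exists (fun i => ev 'X^i); first by move=> i; exists 'X^i.
move=> c sum0 i; pose p := rVpoly (\row_i c i).
suff p0 : p = 0.
  by have := coef_rVpoly_ord (\row_i c i) i; rewrite -/p p0 coef0 mxE.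
apply/eqP; apply: contraT => /ev_neq0/(_ (size_poly _ _))/negP[].
rewrite (eval_at_wide (size_poly _ _)) -[X in _ == X]sum0; apply/eqP.
apply: eq_bigr => j _.
by rewrite coef_rVpoly_ord mxE /eval_at map_polyXn hornerXn.
Qed.

Lemma deg_sum_lt_half d (f g : {poly K}) : (1 <= d)%N ->
  dim_geq iota (adjoin_field iota chi) (2 * d) ->
  (size f <= d)%N -> (size g <= d)%N -> deg_sum_lt iota chi f g.
Proof.
move=> d1 hd sf sg; apply: dim_geq_adjoin_ring => p p0 sp.
apply: (dim_geq_eval_neq0 hd p0); apply: leq_trans sp _.
(* Both degrees are at most [d - 1], so their sum plus one is at most [2d - 1]. Positivity of [d]
   covers zero polynomials, whose predecessor of size is truncated to 0. *)
case: d d1 sf sg {hd} => // d _ sf sg.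
by rewrite mul2n doubleS -addnn ltnS leqW // leq_add // -subn1 leq_subLR.
Qed.

End Evaluation.

Section ResidueField.
Variables (K : fieldType) (Phi : {poly K}) (hPhi : monic_irreducible_poly Phi).

(** The quotient type is built on [mk_monic Phi], which defaults to ['X] when [Phi] is constant or
    not monic. *)
Lemma mk_monic_irreducible : mk_monic Phi = Phi.
Proof. by rewrite /mk_monic (hPhi.1.1) (hPhi.2 : Phi \is monic). Qed.

Lemma size_qfpoly (f : {poly %/ Phi with hPhi}) :
  (size (f : {poly %/ Phi}) < size Phi)%N.
Proof.
have := size_mk_monic f.
by rewrite [X in (_ < size (polyseq X))%N -> _]mk_monic_irreducible.
Qed.

(** The quotient multiplies through the pseudo-remainder [rmodp], which is the euclidean remainder
    because [Phi] is monic. *)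
Lemma qfpolyM (f g : {poly %/ Phi with hPhi}) :
  (f * g : {poly %/ Phi}) =
    (((f : {poly %/ Phi}) : {poly K}) * (g : {poly %/ Phi})) %% Phi :> {poly K}.
Proof.
rewrite Pdiv.IdomainMonic.modpE; last exact: hPhi.2.
by rewrite -[X in Pdiv.CommonRing.rmodp _ X]mk_monic_irreducible.
Qed.

Lemma qfpoly_repr (p : {poly K}) : (size p < size Phi)%N ->
  exists f : {poly %/ Phi with hPhi}, (f : {poly %/ Phi}) = p :> {poly K}.
Proof.
move=> sp; exists (in_qpoly Phi p).
by rewrite in_qpoly_small // mk_monic_irreducible.
Qed.

End ResidueField.

Theorem proposition2p5 (K L : fieldType) (iota : {rmorphism K -> L}) (chi : L)
    (chi_notin_K : forall x : K, iota x <> chi)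
    (L_eq_K_chi : adjoin_field iota chi = [set: L])
    (G : porderZmodType) (hG : linearly_ordered_group G)
    (nu : L -> withInfty G)
    (nuK_rank : finite_rank (base_value_group iota nu))
    (nu_pm : pm_valuation iota chi nu)
    (d : nat) (Phi : {poly K})
    (hPhi : monic_irreducible_poly Phi)
    (deg_Phi : size Phi = d.+1)
    (d_ge1 : (1 <= d)%N)
    (d_le_half : dim_geq iota (adjoin_field iota chi) (2 * d)) :
  w_key_polynomial iota chi nu Phi <->
  field_valuation (residue_valuation iota chi nu hPhi).
Proof.
have [[nu0 nuD _] nuM _] := nu_pm.
have lt_half (f g : {poly K}) :
    (size f < size Phi)%N -> (size g < size Phi)%N ->
    deg_sum_lt iota chi f g.
  by rewrite deg_Phi !ltnS; apply: deg_sum_lt_half.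
split=> [key | [_ _ nuM'] f g sf sg fg].
- split=> [f | f g | f g]; rewrite /residue_valuation.
  + split=> [/nu0/eqP ev0 | ->]; last by apply/nu0; rewrite eval_at0.
    (* A nonzero representative has size at most [d <= 2 * d], hence cannot vanish at [chi]. *)
    apply/val_inj/eqP; apply: contraTT ev0.
    move=> /dim_geq_eval_neq0; apply; first exact: d_le_half.
    have := size_qfpoly f; rewrite deg_Phi ltnS => /leq_trans; apply.
    by rewrite leq_pmull.
  + by rewrite eval_atD; apply: nuD.
  (* The key property trades the remainder for the product in [L], where [nu] is multiplicative in
     these degrees. *)
  + rewrite qfpolyM -key ?size_qfpoly ?nuM //; apply: lt_half; exact: size_qfpoly.
- have [[f' <-] [g' <-]] := (qfpoly_repr hPhi sf, qfpoly_repr hPhi sg).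
  rewrite -qfpolyM nuM; last by apply: lt_half; exact: size_qfpoly.
  by have := nuM' f' g'; rewrite /residue_valuation => ->.
Qed.
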